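(* Let $f$ be a bicritical rational map and $k\in\mathbb{N}$. Then $\mathrm{Deck}(f^k)$ is either cyclic or dihedral (where the Klein four-group $V_4$ counts as dihedral). Furthermore, if the degree of $f$ is odd, then $\mathrm{Deck}(f^k)$ is cyclic.
   Context: A rational map of degree $d\ge2$ is bicritical if it has exactly two critical points. For a rational map $F$, the deck group is $\mathrm{Deck}(F)=\{\tau \text{ Möbius transformation} : F\circ\tau = F\}$. $f^k$ denotes the $k$-th iterate of $f$. *)

(* Defs.v *)
From mathcomp Require Import all_boot all_algebra.
From mathcomp Require Import Rstruct complex.
From Stdlib Require Rdefinitions.

Set Implicit Arguments.
Unset Strict Implicit.
Unset Printing Implicit Defensive.

Import GRing.Theory.
Local Open Scope ring_scope.

Definition CC : numClosedFieldType := complex Rdefinitions.R.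

(** The Riemann sphere: [Some z] is the finite point [z], [None] is infinity. *)
Definition sphere := option CC.

Definition rdeg (P Q : {poly CC}) : nat := (maxn (size P) (size Q)).-1.

(** The rational map z |-> P(z)/Q(z) on the Riemann sphere
    (P, Q coprime, not both constant). *)
Definition ratmap (P Q : {poly CC}) (x : sphere) : sphere :=
  match x with
  | Some z => if Q.[z] != 0 then Some (P.[z] / Q.[z]) else None
  | None =>
      if (size Q < size P)%N then None
      else if size P == size Q then Some (lead_coef P / lead_coef Q)
      else Some 0
  end.

Definition is_ratmap (P Q : {poly CC}) : Prop :=
  coprimep P Q /\ (2 <= rdeg P Q)%N.

(** Local degree (multiplicity of the point in its fibre) of P/Q at x.
    At a finite point z with value c, it is the multiplicity of z as a root
    of P - c Q (resp. of Q if the value is infinity); at infinity it is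
    d minus the degree of P - c Q (resp. of Q), d = rdeg P Q. *)
Definition local_degree (P Q : {poly CC}) (x : sphere) : nat :=
  match x, ratmap P Q x with
  | Some z, Some c => mup z (P - c *: Q)
  | Some z, None => mup z Q
  | None, Some c => (rdeg P Q).+1 - size (P - c *: Q)
  | None, None => (rdeg P Q).+1 - size Q
  end.

Definition critical_point (P Q : {poly CC}) (x : sphere) : Prop :=
  (2 <= local_degree P Q x)%N.

Definition bicritical (P Q : {poly CC}) : Prop :=
  is_ratmap P Q /\
  exists c1 c2 : sphere, c1 <> c2 /\
    forall x, critical_point P Q x <-> (x = c1 \/ x = c2).

Definition mobius_fun (a b c d : CC) (x : sphere) : sphere :=
  match x with
  | Some z => if c * z + d != 0 then Some ((a * z + b) / (c * z + d)) else None
  | None => if c != 0 then Some (a / c) else None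
  end.

Definition is_mobius (t : sphere -> sphere) : Prop :=
  exists a b c d : CC, a * d - b * c != 0 /\ forall x, t x = mobius_fun a b c d x.

Definition iterate (k : nat) (f : sphere -> sphere) : sphere -> sphere :=
  fun x => iter k f x.

Definition Deck (F : sphere -> sphere) (t : sphere -> sphere) : Prop :=
  is_mobius t /\ forall x, F (t x) = F x.

(** [is_zpow s t] : t = s^n for some integer n (t = s^n, or s^n o t = id). *)
Definition is_zpow (s t : sphere -> sphere) : Prop :=
  exists n : nat,
    (forall x, t x = iterate n s x) \/ (forall x, iterate n s (t x) = x).

Definition cyclic_group (G : (sphere -> sphere) -> Prop) : Prop :=
  exists s, G s /\ forall t, G t <-> is_zpow s t.

(** G is dihedral: generated by s and an involution r not in <s> with
    r s r = s^-1, every element being s^n or s^n r (n integer).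
    This includes the Klein four-group (s of order 2). *)
Definition dihedral_group (G : (sphere -> sphere) -> Prop) : Prop :=
  exists s r, G s /\ G r /\
    (forall x, r (r x) = x) /\
    (forall x, r (s (r (s x))) = x) /\
    ~ is_zpow s r /\
    forall t, G t <-> (is_zpow s t \/ exists u, is_zpow s u /\ forall x, t x = u (r x)).

(* Main.v *)
Require Import Defs.
From mathcomp Require Import all_boot all_algebra all_fingroup all_solvable.
From mathcomp Require Import all_field boolp ring zify.

(** By Riemann-Hurwitz, both critical points of a bicritical map f of degree d
    have local degree d, so f = A o z^d o B for Moebius maps A and B.  Hence
    G = Deck (f^k) contains, for k > 0, a rotation of order d with a fixed
    point.  Moreover G is finite and acts freely on a generic fibre of f^k, so
    its order divides d^k and every prime divisor of |G| divides d.

    Nontrivial elements of G have exactly two fixed points on the sphere, so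
    Burnside's lemma leaves two or three orbits of points with nontrivial
    stabilizer.  Two orbits: G fixes a point and is cyclic.  Three orbits: the
    stabilizer orders are (2,2,m), the dihedral case, or (2,3,m) with m < 6;
    the latter is impossible, since 6 would divide |G|, hence d, hence
    the order of some stabilizer.  For odd d no stabilizer has order 2. *)

Set Implicit Arguments.
Unset Strict Implicit.
Unset Printing Implicit Defensive.

Import GRing.Theory Num.Theory.

(** * Finite groups whose nontrivial elements have two fixed points *)

Lemma cards3P (T : finType) (A : {set T}) : #|A| = 3 ->
  exists x y z, [/\ x != y, x != z, y != z & A = [set x; y; z]].
Proof.
move=> A3; have /card_gt0P[x xA] : 0 < #|A| by rewrite A3.
have : #|A :\ x| == 2 by move: (cardsD1 x A); rewrite xA A3; lia.
case/cards2P=> y [z [yz e]]; exists x, y, z.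
have: y \in A :\ x by rewrite e set21.
have: z \in A :\ x by rewrite e set22.
rewrite !inE ![_ == x]eq_sym => /andP[xz _] /andP[xy _]; split=> //.
by rewrite -(setD1K xA) e setUA.
Qed.

(** Here [a], [b], [c] are orbit sizes and [ra], [rb], [rc] stabilizer orders. The sum condition
    reads 1/ra + 1/rb + 1/rc = 1 + 2/n, and a sum above 1 forces [ra = 2] and [rb < 4]. Then
    [rb = 2] is the dihedral case, where [c = 2]. *)
Lemma orbit_size_arith_sorted (n d k a b c ra rb rc : nat) :
  a * ra = n -> b * rb = n -> c * rc = n -> a + b + c = n + 2 -> 0 < n ->
  n %| d ^ k -> 1 < ra -> ra <= rb -> rb <= rc ->
  (d %| ra) || (d %| rb) || (d %| rc) ->
  ~~ odd d /\ c = 2.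
Proof.
move=> ea eb ec s n0 dvd ha hb hc dr.
have pd p : prime p -> p %| n -> p %| d.
  by move=> pp pn; move: (dvdn_trans pn dvd); rewrite Euclid_dvdX // => /andP[].
have bd x r m : x * r = n -> m <= r -> x * m <= n.
  by move=> <- h; rewrite leq_mul2l h orbT.
have er : ra = 2.
  apply/eqP; rewrite eqn_leq ha andbT leqNgt; apply/negP => h.
  have := bd _ _ 3 ea h; have := bd _ _ 3 eb (leq_trans h hb).
  have := bd _ _ 3 ec (leq_trans h (leq_trans hb hc)); clear -s n0; lia.
move: ea hb dr; rewrite er => ea hb dr.
have n2 : 2 %| n by rewrite -ea dvdn_mull.
have d2 : 2 %| d by rewrite pd.
split; first by rewrite -dvdn2.
have : rb < 4.
  rewrite ltnNge; apply/negP => h.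
  have := bd _ _ 4 eb h; have := bd _ _ 4 ec (leq_trans h hc); clear -s ea; lia.
case: rb eb hb hc dr => [|[|[|[|]]]] // eb _ hc dr _; first by clear -s ea eb; lia.
(* The case [rb = 3]: both 2 and 3 divide [n], hence [d]. Since [d] divides a stabilizer order and 6
   divides neither 2 nor 3, [rc] is at least 6, and the orbit sizes add up to at most n/2 + n/3 +
   n/6 = n. *)
have d3 : 3 %| d by rewrite pd // -eb dvdn_mull.
have d6 : 6 %| d by rewrite (@Gauss_dvd 2 3) // d2.
move: dr => /orP[/orP[]|] /(dvdn_trans d6) // /dvdn_leq h.
have := bd _ _ 6 ec (h (ltnW (ltnW hc))); clear -s ea eb; lia.
Qed.

Lemma orbit_size_arith (n d k a b c ra rb rc : nat) :
  a * ra = n -> b * rb = n -> c * rc = n -> a + b + c = n + 2 -> 0 < n ->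
  n %| d ^ k -> 1 < ra -> 1 < rb -> 1 < rc ->
  (d %| ra) || (d %| rb) || (d %| rc) ->
  ~~ odd d /\ [|| a == 2, b == 2 | c == 2].
Proof.
have main x y z rx ry rz : x * rx = n -> y * ry = n -> z * rz = n ->
   x + y + z = n + 2 -> 0 < n -> n %| d ^ k -> 1 < rx -> rx <= ry -> ry <= rz ->
   [|| d %| rx, d %| ry | d %| rz] -> ~~ odd d /\ [|| x == 2, y == 2 | z == 2].
  move=> ex ey ez s n0 dv hx hy hz dr.
  rewrite orbA in dr.
  by have [-> ->] := orbit_size_arith_sorted ex ey ez s n0 dv hx hy hz dr; rewrite !orbT.
move=> ea eb ec s n0 dv ha hb hc dr.
have perm x y z rx ry rz : x * rx = n -> y * ry = n -> z * rz = n ->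
   x + y + z = n + 2 -> 1 < rx -> rx <= ry -> ry <= rz ->
   [|| d %| rx, d %| ry | d %| rz] = [|| d %| ra, d %| rb | d %| rc] ->
   [|| x == 2, y == 2 | z == 2] = [|| a == 2, b == 2 | c == 2] ->
   ~~ odd d /\ [|| a == 2, b == 2 | c == 2].
  move=> ex ey ez s' hx hy hz e1 <-; apply: main ex ey ez s' n0 dv hx hy hz _.
  by rewrite e1 orbA.
have e3 : [/\ b + a + c = n + 2, a + c + b = n + 2, c + a + b = n + 2, b + c + a = n + 2
  & c + b + a = n + 2] by clear -s; split; lia.
have [sba sac sca sbc scb] := e3.
(* Everything is symmetric in the three orbits, so it is enough to sort the stabilizer orders. *)
have [l1|/ltnW l1] := leqP ra rb; have [l2|/ltnW l2] := leqP rb rc;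
  have [l3|/ltnW l3] := leqP ra rc;
  [ apply: (perm _ _ _ _ _ _ ea eb ec) | apply: (perm _ _ _ _ _ _ ea eb ec)
  | apply: (perm _ _ _ _ _ _ ea ec eb) | apply: (perm _ _ _ _ _ _ ec ea eb)
  | apply: (perm _ _ _ _ _ _ eb ea ec) | apply: (perm _ _ _ _ _ _ eb ec ea)
  | apply: (perm _ _ _ _ _ _ ec eb ea) | apply: (perm _ _ _ _ _ _ ec eb ea)] => //;
  case: (d %| ra); case: (d %| rb); case: (d %| rc);
  case: (a == 2); case: (b == 2); case: (c == 2) => //.
Qed.

(** The two outcomes are the two shapes of a deck group: a common fixed point makes it cyclic, and
    an orbit of size two consists of the poles of the rotations in a dihedral group. *)
Lemma rotation_group_orbits (T : finType) (G : {group {perm T}}) (d k : nat) (x0 : T) :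
  1 < d -> d %| #|'C_G[x0 | 'P]%g| -> #|G| %| d ^ k ->
  (forall g, g \in G -> g != 1%g -> #|'Fix_'P[g]%g| = 2) ->
  (exists x, G \subset 'C[x | 'P]%g) \/
  (~~ odd d /\ exists x, #|orbit 'P%act G x| = 2).
Proof.
move=> d1 dx0 dvdG fix2.
pose S := [set x | 1 < #|'C_G[x | 'P]%g|].
have orbst x : #|orbit 'P%act G x| * #|'C_G[x | 'P]%g| = #|G|.
  exact: card_orbit_stab.
have orbgt0 x : 0 < #|orbit 'P%act G x|.
  by apply/card_gt0P; exists x; exact: orbit_refl.
have x0S : x0 \in S by rewrite inE (leq_trans d1) // dvdn_leq // cardG_gt0.
have G1 : 1 < #|G|.
  by move: x0S; rewrite inE => /leq_trans -> //; rewrite subset_leq_card // subsetIl.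
have orbeq x y : y \in orbit 'P%act G x -> #|'C_G[y | 'P]%g| = #|'C_G[x | 'P]%g|.
  move=> yx; have := orbst y.
  by rewrite (orbit_eqP yx) -(orbst x) => /eqP; rewrite eqn_pmul2l // => /eqP.
have actS : [acts G, on S | 'P]%g.
  apply/actsP => g gG x /=; rewrite !inE (@orbeq x) //.
  exact: (mem_orbit 'P%act x gG).
(* A point fixed by a nontrivial element has a nontrivial stabilizer, so restricting the action to
   [S] loses no fixed point. *)
have fixS g : g \in G -> g != 1%g -> #|'Fix_(S | 'P)[g]%g| = 2.
  move=> gG g1; rewrite -(fix2 g) //; congr #|pred_of_set _|.
  apply/setIidPr/subsetP => x fx; rewrite inE (cardD1 1%g) group1 ltnS.
  apply/card_gt0P; exists g; rewrite !inE g1 gG /=.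
  by apply/subsetP => y; rewrite !inE => /eqP ->; move/afix1P: fx => /= ->.
pose O := orbit 'P%act G @: S.
(* The identity fixes all of [S], and each of the other |G| - 1 elements fixes two points. *)
have Burnside : #|S| + 2 * #|G|.-1 = #|O| * #|G|.
  rewrite -(Frobenius_Cauchy actS) (big_setD1 1%g) ?group1 //=; congr (_ + _).
    by congr #|pred_of_set _|; apply/esym/setIidPl/subsetP => x _; apply/afix1P; rewrite act1.
  rewrite (eq_bigr (fun=> 2)) => [|g]; last by rewrite !inE => /andP[g1 gG]; exact: fixS.
  by rewrite sum_nat_const mulnC (cardsD1 1%g) group1.
have cS : #|S| = \sum_(A in O) #|A|.
  by rewrite acts_sum_card_orbit.
have leO A : A \in O -> 0 < #|A| /\ 2 * #|A| <= #|G|.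
  case/imsetP => x; rewrite inE => xS ->; split=> //.
  by rewrite -(orbst x) mulnC leq_mul2l xS orbT.
have lbS : #|O| <= #|S|.
  by rewrite cS -sum1_card; apply: leq_sum => A /leO[].
have ubS : 2 * #|S| <= #|O| * #|G|.
  by rewrite cS big_distrr /= -sum_nat_const; apply: leq_sum => A /leO[].
(* Burnside's count combined with |O| <= |S| <= |O| |G| / 2, the upper bound coming from stabilizers
   of order at least 2, leaves only two or three orbits. *)
have O2 : 1 < #|O|.
  move: Burnside lbS G1; clear; case: #|O| => [|[|//]]; last by lia.
  by rewrite mul0n; lia.
have O3 : #|O| < 4.
  rewrite ltnNge; apply/negP => O4; have := leq_mul O4 (leqnn #|G|).
  move: Burnside ubS G1; clear; lia.
have orbS A : A \in O -> exists2 x, x \in S & A = orbit 'P%act G x.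
  by case/imsetP => x; exists x.
have x0O : orbit 'P%act G x0 \in O by apply: imset_f.
have [O2'|O3'] : #|O| = 2 \/ #|O| = 3 by clear -O2 O3; lia.
  (* With two orbits the count gives |S| = 2, so both orbits are single points and [G] fixes
     [x0]. *)
  left; exists x0; have S2 : #|S| = 2 by rewrite O2' in Burnside; clear -Burnside G1; lia.
  have o1 : #|orbit 'P%act G x0| = 1.
    move: cS; rewrite S2 (bigD1 _ x0O) /=.
    have : 0 < \sum_(i in O | i != orbit 'P%act G x0) #|i|.
      rewrite (cardsD1 (orbit 'P%act G x0)) x0O in O2'.
      have /card_gt0P[A] : 0 < #|O :\ orbit 'P%act G x0| by clear -O2'; lia.
      rewrite !inE => /andP[A1 A2]; rewrite (bigD1 A) ?A1 ?A2 //=.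
      by have [A0 _] := leO A A2; rewrite ltn_addr.
    by move: (orbgt0 x0); set o := #|_|; set q := bigop _ _ _; clear; lia.
  apply/setIidPl/eqP; rewrite eqEcard subsetIl /=.
  by rewrite -(orbst x0) o1 mul1n.
right; have [A [B [C [AB AC BC eO]]]] := cards3P O3'.
have [AO BO CO] : [/\ A \in O, B \in O & C \in O] by rewrite eO !inE !eqxx !orbT.
have [[a aS eA] [b bS eB] [c cS' eC]] := And3 (orbS _ AO) (orbS _ BO) (orbS _ CO).
have sum : #|A| + #|B| + #|C| = #|G| + 2.
  move: cS; rewrite eO -setUA !big_setU1 ?inE ?negb_or ?AB ?AC //=.
  rewrite big_set1 addnA => <-; rewrite O3' in Burnside.
  have ar m n : 1 < n -> m + 2 * n.-1 = 3 * n -> m = n + 2 by clear; lia.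
  exact: ar G1 Burnside.
rewrite eA eB eC in sum; rewrite !inE in aS bS cS'.
(* Stabilizer orders are constant along orbits, and the orbit of [x0] is one of the three. *)
have dr : (d %| #|'C_G[a | 'P]%g|) || (d %| #|'C_G[b | 'P]%g|) || (d %| #|'C_G[c | 'P]%g|).
  have e z : orbit 'P%act G x0 = orbit 'P%act G z -> d %| #|'C_G[z | 'P]%g|.
    by move=> ez; rewrite -(@orbeq z x0) // -ez orbit_refl.
  move: x0O; rewrite eO eA eB eC !inE => /orP[/orP[]|] /eqP/e ->; rewrite ?orbT //.
have [od o2] := orbit_size_arith (orbst a) (orbst b) (orbst c) sum (ltnW G1) dvdG aS bS cS' dr.
by split=> //; case/or3P: o2 => /eqP o2; [exists a | exists b | exists c].
Qed.

Local Open Scope ring_scope.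

(** * Moebius transformations *)

(** The point with homogeneous coordinates [x : y]. In these coordinates Moebius maps act linearly,
    which removes the case distinctions at infinity. *)
Definition proj (x y : CC) : sphere := if y != 0 then Some (x / y) else None.

Lemma projZ (k x y : CC) : k != 0 -> proj (k * x) (k * y) = proj x y.
Proof.
move=> k0; rewrite /proj mulf_eq0 (negbTE k0) /=.
by case: eqVneq => //= y0; congr Some; field; rewrite k0 y0.
Qed.

Lemma sphere_projP (x : sphere) :
  exists u v : CC, ((u != 0) || (v != 0)) /\ x = proj u v.
Proof.
case: x => [z|].
  by exists z, 1; rewrite oner_neq0 orbT /proj oner_neq0 divr1.
by exists 1, 0; rewrite oner_neq0 /proj eqxx.
Qed.

Lemma mobius_proj (a b c d x y : CC) : (x != 0) || (y != 0) ->
  mobius_fun a b c d (proj x y) = proj (a * x + b * y) (c * x + d * y).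
Proof.
rewrite /proj /mobius_fun; case: (eqVneq y 0) => [->|y0] /=.
  rewrite orbF !mulr0 !addr0 => x0; rewrite mulf_eq0 (negbTE x0) orbF.
  by case: eqVneq => //= c0; congr Some; field; rewrite x0 c0.
move=> _; have -> : c * (x / y) + d = (c * x + d * y) / y by field.
rewrite mulf_eq0 invr_eq0 (negbTE y0) orbF; case: eqVneq => //= n0.
by congr Some; field; rewrite y0 n0.
Qed.

Lemma mobius_nz (a b c d x y : CC) : a * d - b * c != 0 ->
  (x != 0) || (y != 0) -> (a * x + b * y != 0) || (c * x + d * y != 0).
Proof.
move=> D; apply: contraLR; rewrite !negb_or !negbK => /andP[/eqP e1 /eqP e2].
have ex : (a * d - b * c) * x = d * (a * x + b * y) - b * (c * x + d * y) by ring.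
have ey : (a * d - b * c) * y = a * (c * x + d * y) - c * (a * x + b * y) by ring.
move: ex ey; rewrite e1 e2 !mulr0 subr0 => /eqP ex /eqP ey.
by move: ex ey; rewrite !mulf_eq0 (negbTE D) /= => -> ->.
Qed.

Lemma mobius_fun_comp (a b c d a' b' c' d' : CC) (x : sphere) :
  a' * d' - b' * c' != 0 ->
  mobius_fun a b c d (mobius_fun a' b' c' d' x) =
  mobius_fun (a * a' + b * c') (a * b' + b * d')
             (c * a' + d * c') (c * b' + d * d') x.
Proof.
move=> D; have [u [v [nz ->]]] := sphere_projP x.
by rewrite !mobius_proj ?mobius_nz //; congr proj; ring.
Qed.

Lemma mobius_fun_scalar (a : CC) (x : sphere) : a != 0 -> mobius_fun a 0 0 a x = x.
Proof.
move=> a0; have [u [v [nz ->]]] := sphere_projP x.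
by rewrite mobius_proj // !mul0r addr0 add0r projZ.
Qed.

Lemma mobius_id : is_mobius id.
Proof.
exists 1, 0, 0, 1; rewrite mul0r subr0 mulr1 oner_neq0; split=> // x.
by rewrite mobius_fun_scalar ?oner_neq0.
Qed.

Lemma mobius_comp t s : is_mobius t -> is_mobius s -> is_mobius (t \o s).
Proof.
move=> [a [b [c [d [D et]]]]] [a' [b' [c' [d' [D' es]]]]].
exists (a * a' + b * c'), (a * b' + b * d'), (c * a' + d * c'), (c * b' + d * d').
split=> [|x]; last by rewrite /= es et mobius_fun_comp.
suff -> : (a * a' + b * c') * (c * b' + d * d') - (a * b' + b * d') * (c * a' + d * c')
  = (a * d - b * c) * (a' * d' - b' * c') by rewrite mulf_neq0.
ring.
Qed.

Lemma mobius_inv t : is_mobius t ->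
  exists s, [/\ is_mobius s, cancel t s & cancel s t].
Proof.
(* The adjugate matrix is the inverse up to the scalar [a * d - b * c]. *)
move=> [a [b [c [d [D et]]]]]; exists (mobius_fun d (- b) (- c) a).
have D' : d * a - - b * - c != 0 by rewrite mulrNN mulrC.
split; first by exists d, (- b), (- c), a.
- move=> x; rewrite et mobius_fun_comp //.
  rewrite -[RHS](@mobius_fun_scalar (a * d - b * c)) //; congr mobius_fun; ring.
- move=> x; rewrite et mobius_fun_comp //.
  rewrite -[RHS](@mobius_fun_scalar (a * d - b * c)) //; congr mobius_fun; ring.
Qed.

Lemma mobius_to_infty (x : sphere) : exists2 t, is_mobius t & t x = None.
Proof.
case: x => [z|]; last by exists id => //; exact: mobius_id.
exists (mobius_fun 0 1 1 (- z)); last by rewrite /= mul1r subrr eqxx.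
by exists 0, 1, 1, (- z); rewrite mul0r sub0r mulr1 oppr_eq0 oner_neq0.
Qed.

Lemma mobius_affine t : is_mobius t -> t None = None ->
  exists a b : CC, a != 0 /\ forall z, t (Some z) = Some (a * z + b).
Proof.
move=> [a [b [c [d [D et]]]]]; rewrite et /=.
case: eqVneq => //= c0 _; move: D; rewrite c0 mulr0 subr0 mulf_eq0 negb_or => /andP[a0 d0].
exists (a / d), (b / d); split; first by rewrite mulf_neq0 ?invr_neq0.
by move=> z; rewrite et /= c0 mul0r add0r d0; congr Some; field.
Qed.

Lemma mobius_has_fixpoint t : is_mobius t -> exists x, t x = x.
Proof.
move=> [a [b [c [d [D et]]]]]; have [c0|c0] := eqVneq c 0.
  by exists None; rewrite et /= c0 eqxx.
(* Finite fixed points solve c z^2 + (d - a) z - b = 0; [s] is a square root of its discriminant. *)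
pose s := sqrtC ((a - d) ^+ 2 + 4%:R * b * c).
pose z := ((a - d) + s) / (2%:R * c).
have t0 : 2%:R != 0 :> CC by rewrite pnatr_eq0.
have es : s ^+ 2 = (a - d) ^+ 2 + 4%:R * b * c by rewrite sqrtCK.
have ez : z * (c * z + d) - (a * z + b) = 0.
  have -> : z * (c * z + d) - (a * z + b) =
     (s ^+ 2 - ((a - d) ^+ 2 + 4%:R * b * c)) / (4%:R * c).
    by rewrite /z; field; rewrite c0.
  by rewrite es subrr mul0r.
(* The root [z] is not the pole: there the numerator would vanish too, against the nonzero
   determinant. *)
exists (Some z); rewrite et /=; case: eqVneq => [n0|n0] /=.
  case/negP: D; move/eqP: ez; rewrite n0 mulr0 sub0r oppr_eq0 => /eqP n1.
  have nz : (z != 0) || (1 != 0 :> CC) by rewrite oner_neq0 orbT.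
  apply/negPn/negP => D; move: (mobius_nz D nz).
  by rewrite !mulr1 n0 n1 eqxx.
by congr Some; apply: (mulIf n0); rewrite mulfVK //; apply/eqP; rewrite eq_sym -subr_eq0 ez.
Qed.

(** Moving [x] to infinity makes the map affine, and an affine map fixing two distinct numbers is
    the identity. *)
Lemma mobius_fix3 t (x y z : sphere) : is_mobius t ->
  x != y -> x != z -> y != z -> t x = x -> t y = y -> t z = z -> t =1 id.
Proof.
move=> tM xy xz yz tx ty tz.
have [N NM Nx] := mobius_to_infty x; have [M [MM NK MK]] := mobius_inv NM.
have uM : is_mobius (N \o t \o M) by apply: mobius_comp => //; apply: mobius_comp.
have [|a [b [a0 e]]] := mobius_affine uM.
  by rewrite /= -Nx NK tx.
have fin v : x != v -> exists w, N v = Some w.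
  case Nv: (N v) => [w|]; first by exists w.
  by rewrite -(inj_eq (can_inj NK)) Nv Nx eqxx.
have [[y' ey] [z' ez]] := (fin _ xy, fin _ xz).
have := e y'; rewrite /= -ey NK ty ey => -[ey'].
have := e z'; rewrite /= -ez NK tz ez => -[ez'].
have yz' : y' - z' != 0.
  by rewrite subr_eq0; apply: contraNneq yz => e1; rewrite -(inj_eq (can_inj NK)) ey ez e1.
have a1 : a = 1.
  apply: (mulIf yz'); rewrite mul1r {2}ey' {2}ez'; ring.
have b0 : b = 0 by apply/eqP; rewrite -(inj_eq (addrI y')) addr0 {2}ey' a1 mul1r.
have uid v : (N \o t \o M) v = v.
  case: v => [v|]; last by rewrite /= -Nx NK tx.
  by rewrite e a1 b0 mul1r addr0.
by move=> v; apply: (can_inj NK); rewrite -{1}(NK v); exact: uid.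
Qed.

Lemma mobius_at_most_two_fix t : is_mobius t -> ~ t =1 id ->
  exists l : seq sphere, forall x, t x = x -> x \in l.
Proof.
move=> tM tid; have [x tx] := mobius_has_fixpoint tM.
case: (pselect (exists2 y, x != y & t y = y)) => [[y xy ty]|no].
  exists [:: x; y] => z tz; rewrite !inE; apply/negPn/negP; rewrite negb_or => /andP[zx zy].
  by apply: tid; apply: (@mobius_fix3 t x y z) => //; rewrite eq_sym.
exists [:: x] => z tz; rewrite inE eq_sym; apply/negPn/negP => zx; apply: no.
by exists z.
Qed.

Lemma iterate_conj (N M t : sphere -> sphere) n : cancel N M ->
  forall x, iterate n (N \o t \o M) (N x) = N (iterate n t x).
Proof. by move=> NK x; elim: n => //= n; rewrite /iterate /= => ->; rewrite NK. Qed.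

Lemma iterate_translation (t : sphere -> sphere) (b z : CC) n :
  (forall z : CC, t (Some z) = Some (z + b)) -> iterate n t (Some z) = Some (z + b *+ n).
Proof.
move=> e; elim: n => [|n IH]; first by rewrite mulr0n addr0.
by rewrite /iterate /= -/(iterate n t _) IH e mulrSr addrA.
Qed.

Definition finite_order (t : sphere -> sphere) := exists2 n, (0 < n)%N & iterate n t =1 id.

(** The n-th iterate of translation by [b] is translation by n b, so in characteristic zero finite
    order forces b = 0. *)
Lemma conj_translation_finite_order (N M t : sphere -> sphere) (b : CC) :
  cancel N M -> cancel M N -> finite_order t -> (N \o t \o M) None = None ->
  (forall z : CC, (N \o t \o M) (Some z) = Some (z + b)) -> t =1 id.
Proof.
move=> NK MK [n n0 tn] eN e.
have := iterate_translation 0 n e; rewrite -{1}(MK (Some 0)) iterate_conj // tn MK add0r.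
case=> /esym/eqP; rewrite mulrn_eq0 eqn0Ngt n0 /= => /eqP b0 y.
apply: (can_inj NK); rewrite -{1}(NK y) -[LHS]/((N \o t \o M) (N y)).
by case: (N y) => [z|]; [rewrite e b0 addr0 | exact: eN].
Qed.

(* A fixed point at which the derivative is 1 makes the map a translation in
   the coordinate sending that point to infinity. *)
Lemma stabilizer_multiplier (x : sphere) : exists mu : (sphere -> sphere) -> CC,
  [/\ mu id = 1,
      forall t s, is_mobius t -> is_mobius s -> t x = x -> s x = x ->
        mu (t \o s) = mu t * mu s &
      forall t, is_mobius t -> t x = x -> finite_order t -> mu t = 1 -> t =1 id].
Proof.
have [N NM Nx] := mobius_to_infty x; have [M [MM NK MK]] := mobius_inv NM.
pose c t := N \o t \o M; pose va (y : sphere) := if y is Some z then z else 0 : CC.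
have vaE z : va (Some z) = z by [].
(* For [t] fixing [x], the conjugate [c t] is affine and this difference is its slope; the default
   value of [va] at infinity is then never met. *)
pose mu t := va (c t (Some 1)) - va (c t (Some 0)).
have aff t : is_mobius t -> t x = x ->
    exists b, forall z : CC, c t (Some z) = Some (mu t * z + b).
  move=> tM tx; have cM : is_mobius (c t) by do 2!apply: mobius_comp => //.
  have [|a [b [a0 e]]] := mobius_affine cM; first by rewrite /c /= -Nx NK tx.
  exists b => z; rewrite e; congr (Some (_ * _ + _)).
  by rewrite /mu !e !vaE; ring.
exists mu; split.
- by rewrite /mu /c /= !MK /= subr0.
- move=> t s tM sM tx sx; have [[b eb] [b' eb']] := (aff _ tM tx, aff _ sM sx).
  have e z : c (t \o s) z = c t (c s z) by rewrite /c /= NK.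
  by rewrite {1}/mu !e !eb' !eb !vaE; ring.
- move=> t tM tx tn m1; have [b e] := aff _ tM tx.
  apply: (conj_translation_finite_order (b := b) NK MK tn) => [|z].
    by rewrite /= -Nx NK tx.
  by rewrite -[LHS]/(c t (Some z)) e m1 mul1r.
Qed.

(** With one fixed point moved to infinity the map is z -> a z + b. Finite order excludes a = 1, so
    b / (1 - a) is a second fixed point. *)
Lemma finite_order_two_fix t : is_mobius t -> finite_order t -> ~ t =1 id ->
  exists x y, [/\ x != y & forall z, t z = z <-> z = x \/ z = y].
Proof.
move=> tM tn tid; have [x tx] := mobius_has_fixpoint tM.
have [N NM Nx] := mobius_to_infty x; have [M [MM NK MK]] := mobius_inv NM.
have cM : is_mobius (N \o t \o M) by do 2!apply: mobius_comp => //.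
have [|a [b [a0 e]]] := mobius_affine cM; first by rewrite /= -Nx NK tx.
have tN z : N (t z) = (N \o t \o M) (N z) by rewrite /= NK.
have a1 : 1 - a != 0.
  rewrite subr_eq0; apply/negP => /eqP a1; apply: tid.
  apply: (conj_translation_finite_order (b := b) NK MK tn) => [|z].
    by rewrite /= -Nx NK tx.
  by rewrite e -a1 mul1r.
pose y := M (Some (b / (1 - a))).
have xy : x != y by apply/eqP => xy; move: Nx; rewrite xy MK.
have ty : t y = y.
  apply: (can_inj NK); rewrite tN MK e; congr Some; field; exact: a1.
exists x, y; split=> // z; split=> [tz|[]-> //].
have [->|zx] := eqVneq z x; first by left.
have [->|zy] := eqVneq z y; first by right.
by case: tid; apply: (@mobius_fix3 t x y z) => //; rewrite eq_sym.
Qed.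

(** * Fibres *)

Definition finite_fibres (F : sphere -> sphere) :=
  forall w, exists l : seq sphere, forall x, F x = w <-> x \in l.

(** The number [n] stands for the degree of [F]; the finite list [bad] makes room for the critical
    values. *)
Definition generic_fibre_size (F : sphere -> sphere) (n : nat) :=
  exists bad : seq sphere, forall w, w \notin bad ->
    exists l : seq sphere, [/\ uniq l, size l = n & forall x, F x = w <-> x \in l].

Lemma finite_preimage F (V : seq sphere) : finite_fibres F ->
  exists l : seq sphere, forall x, x \in l <-> F x \in V.
Proof.
move=> fF; elim: V => [|v V [l IH]]; first by exists [::] => x; rewrite in_nil.
have [l' e] := fF v; exists (l' ++ l) => x; rewrite mem_cat in_cons.
split=> /orP[h|h]; apply/orP.
- by left; apply/eqP/e.
- by right; apply/IH.
- by left; apply/e/eqP.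
- by right; apply/IH.
Qed.

Lemma finite_fibres_comp F H : finite_fibres F -> finite_fibres H ->
  finite_fibres (F \o H).
Proof.
move=> fF fH w; have [l e] := fF w; have [l' e'] := finite_preimage l fH.
by exists l' => x; rewrite e' -e.
Qed.

Lemma fibres_of_list H m (bad l : seq sphere) :
  (forall w, w \notin bad ->
    exists l : seq sphere, [/\ uniq l, size l = m & forall x, H x = w <-> x \in l]) ->
  uniq l -> {in l, forall x, x \notin bad} ->
  exists l' : seq sphere, [/\ uniq l', size l' = (size l * m)%N & forall x, H x \in l <-> x \in l'].
Proof.
move=> gH; elim: l => [|v l IH]; first by exists [::].
rewrite cons_uniq => /andP[vl ul] ok.
have [l1 [u1 s1 e1]] := gH v (ok v (mem_head _ _)).
have [|l2 [u2 s2 e2]] := IH ul; first by move=> x xl; apply: ok; rewrite in_cons xl orbT.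
exists (l1 ++ l2); split.
- rewrite cat_uniq u1 u2 andbT; apply/hasPn => x /e2 xl; apply/negP => /e1 xv.
  by rewrite xv (negbTE vl) in xl.
- by rewrite size_cat s1 s2 mulSn.
- move=> x; rewrite mem_cat in_cons; split=> /orP[h|h]; apply/orP.
  + by left; apply/e1/eqP.
  + by right; apply/e2.
  + by left; apply/eqP/e1.
  + by right; apply/e2.
Qed.

Lemma generic_fibre_size_comp F H n m :
  generic_fibre_size F n -> generic_fibre_size H m ->
  generic_fibre_size (F \o H) (n * m).
Proof.
(* Besides avoiding [b], the value [w] must avoid the image of [b'], so that every point of its
   [F]-fibre is generic for [H]. *)
move=> [b gF] [b' gH]; exists (b ++ map F b') => w.
rewrite mem_cat negb_or => /andP[wb wb']; have [l [ul sl el]] := gF w wb.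
have [|l' [ul' sl' el']] := fibres_of_list gH ul.
  by move=> x /el Fx; apply: contraNN wb' => xb; rewrite -Fx map_f.
by exists l'; rewrite sl' sl; split=> // x; rewrite -el' -el.
Qed.

Lemma fibres_bij (F H : sphere -> sphere) : cancel F H -> cancel H F ->
  finite_fibres F /\ generic_fibre_size F 1.
Proof.
move=> FK HK; have e w x : F x = w <-> x \in [:: H w].
  by rewrite inE; split=> [<-|/eqP->]; rewrite ?FK ?HK.
by split=> [w|]; [exists [:: H w] | exists [::] => w _; exists [:: H w]; split].
Qed.

Lemma fibres_iterate F n k : finite_fibres F -> generic_fibre_size F n ->
  finite_fibres (iterate k F) /\ generic_fibre_size (iterate k F) (n ^ k).
Proof.
move=> fF gF; elim: k => [|k [IH1 IH2]]; first exact: (@fibres_bij id id).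
by split; [apply: finite_fibres_comp fF IH1 | rewrite expnS; apply: generic_fibre_size_comp gF IH2].
Qed.

Definition power_map (d : nat) (x : sphere) : sphere :=
  if x is Some z then Some (z ^+ d) else None.

(** The polynomial X^d - 1 is separable in characteristic zero, so it has d distinct roots, and
    among d distinct d-th roots of unity one is primitive. *)
Lemma prim_root_exists (d : nat) : (0 < d)%N -> exists w : CC, d.-primitive_root w.
Proof.
move=> d0; have d0' : d%:R != 0 :> CC by rewrite pnatr_eq0 -lt0n.
have [rs e] := closed_field_poly_normal ('X^d - 1 : {poly CC}).
rewrite (eqP (monic_Xn_sub_1 _ d0)) scale1r in e.
have urs : uniq rs by rewrite -separable_prod_XsubC -e separable_Xn_sub_1.
have srs : size rs = d.
  by have := size_XnsubC (1 : CC) d0; rewrite e size_prod_XsubC => -[].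
have hr : all d.-unity_root rs.
  apply/allP => x xr; have : root ('X^d - 1) x by rewrite e root_prod_XsubC.
  by rewrite rootE !hornerE subr_eq0 => h; apply/unity_rootP/eqP.
by have /hasP[w _ wp] := has_prim_root d0 hr urs (eq_leq (esym srs)); exists w.
Qed.

Lemma fibres_power_map d : (0 < d)%N ->
  finite_fibres (power_map d) /\ generic_fibre_size (power_map d) d.
Proof.
move=> d0; have [e ep] := prim_root_exists d0.
have fibN x : power_map d x = None <-> x \in [:: None].
  by rewrite inE; case: x.
have fib0 x : power_map d x = Some 0 <-> x \in [:: Some 0].
  rewrite inE; case: x => [z|] //=; split=> [[/eqP]|/eqP[->]].
    by rewrite expf_eq0 => /andP[_ /eqP->].
  by rewrite expr0n -[d]prednK.
have fib v : v != 0 -> exists l : seq sphere,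
   [/\ uniq l, size l = d & forall x, power_map d x = Some v <-> x \in l].
  move=> v0; pose r : CC := d.-root v.
  have rd : r ^+ d = v by rewrite rootCK.
  have r0 : r != 0 by apply: contraNneq v0 => r0; rewrite -rd r0 expr0n -[d]prednK.
  exists [seq Some (r * e ^+ i) | i <- iota 0 d]; split.
  - rewrite map_inj_in_uniq ?iota_uniq // => i j; rewrite !mem_iota !add0n /= => id jd [].
    move/(mulfI r0)/eqP; rewrite (eq_prim_root_expr ep) /eqn !modn_small // => /eqP.
    by [].
  - by rewrite size_map size_iota.
  - case=> [z|] /=; last by split=> // /mapP[].
    split=> [[zd]|/mapP[i _ [->]]]; last by rewrite exprMn exprAC (prim_expr_order ep) expr1n mulr1 rd.
    have h : (z / r) ^+ d = 1 by rewrite expr_div_n zd rd divff.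
    have [i zi] := prim_rootP ep h; apply/mapP; exists (val i).
      by rewrite mem_iota add0n /=.
    by rewrite -zi mulrC mulfVK.
split=> [[v|]|]; last 1 first.
- exists [:: Some 0; None] => -[v|]; rewrite !inE ?eqxx // orbF => v0.
  by apply: fib; apply: contraNneq v0 => ->.
- have [->|/fib[l [_ _ h]]] := eqVneq v 0; first by exists [:: Some 0].
  by exists l.
- by exists [:: None].
Qed.

(** * Bicritical maps as power maps *)

(** Writing R = (X - z)^m T with T(z) nonzero, the Wronskian is (X - z)^(m-1) K, where K(z) = m T(z)
    S(z) is nonzero. *)
Lemma mup_wronskian (F : numFieldType) (R S : {poly F}) (z : F) : R != 0 -> root R z -> ~~ root S z ->
  mup z (R^`() * S - R * S^`()) = (mup z R).-1.
Proof.
move=> R0 Rz Sz; have [m [T + eR]] := multiplicity_XsubC R z.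
rewrite R0 /= => Tz.
have mR : mup z R = m by rewrite eR mupMr // mup_XsubCX eqxx.
case: m => [|m] in eR mR *; first by rewrite eR expr0 mulr1 (negbTE Tz) in Rz.
rewrite mR /=.
pose K := T * S *+ m.+1 + ('X - z%:P) * (T^`() * S - T * S^`()).
have -> : R^`() * S - R * S^`() = K * ('X - z%:P) ^+ m.
  rewrite eR derivM deriv_exp derivXsubC mul1r /= /K -mulr_natr exprS.
  by rewrite -[in LHS]mulr_natr; ring.
rewrite mupMr ?mup_XsubCX ?eqxx //.
rewrite rootE /K hornerD hornerMn hornerM [X in _ + X]hornerM hornerXsubC subrr mul0r addr0.
by rewrite mulrn_eq0 /= mulf_eq0 negb_or -!rootE Tz Sz.
Qed.

Lemma coef_mul_top (K : nzRingType) (p q : {poly K}) (a b : nat) :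
  (size p <= a.+1)%N -> (size q <= b.+1)%N -> (p * q)`_(a + b) = p`_a * q`_b.
Proof.
move=> sp sq; rewrite coefM.
have ha : (a < (a + b).+1)%N by rewrite ltnS leq_addr.
rewrite (bigD1 (Ordinal ha)) //= addKn big1 ?addr0 // => i ia.
have [lt|le] := ltnP i a.
  by rewrite [q`__]nth_default ?mulr0 // (leq_trans sq) //; lia.
rewrite [p`__]nth_default ?mul0r // (leq_trans sp) // ltn_neqAle le andbT.
by rewrite eq_sym.
Qed.

(** The analogue of [mup_wronskian] at infinity: as the degrees of [R] and [S] differ, the top
    coefficients do not cancel. *)
Lemma size_wronskian (F : numFieldType) (R S : {poly F}) (d : nat) : R != 0 -> size S = d.+1 ->
  (size R <= d)%N -> (d + (size R).-1 <= size (R^`() * S - R * S^`())%R)%N.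
Proof.
move=> R0 sS sR; have [m sm] : exists m, size R = m.+1.
  by exists (size R).-1; rewrite prednK // size_poly_gt0.
rewrite sm /=; set W := _ - _.
(* Multiplying by X turns differentiation into the degree-preserving operator that scales the i-th
   coefficient by i. *)
have e : ('X * W)`_(m + d) = (m%:R - d%:R) * (R`_m * S`_d).
  have -> : 'X * W = ('X * R^`()) * S - R * ('X * S^`()) by rewrite /W; ring.
  have cX (p : {poly F}) i : ('X * p^`())`_i = p`_i *+ i.
    by rewrite coefXM; case: i => [|i] //=; rewrite coef_deriv.
  have sX (p : {poly F}) i : (size p <= i.+1)%N -> (size ('X * p^`())%R <= i.+1)%N.
    by move=> h; apply/leq_sizeP => j ij; rewrite cX nth_default ?mul0rn // (leq_trans h).
  rewrite coefB coef_mul_top ?sX ?sm ?sS // coef_mul_top ?sX ?sm ?sS // !cX.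
  by rewrite -[R`_m *+ m]mulr_natr -[S`_d *+ d]mulr_natr; ring.
have n0 : ('X * W)`_(m + d) != 0.
  rewrite e !mulf_neq0 //.
  - by rewrite subr_eq0 eqr_nat neq_ltn; move: sR; rewrite sm => ->.
  - by have := lead_coef_eq0 R; rewrite lead_coefE sm /= => ->.
  - by have := lead_coef_eq0 S; rewrite lead_coefE sS /= => ->; rewrite -size_poly_eq0 sS.
have : (m + d < size ('X * W)%R)%N.
  by rewrite ltnNge; apply: contraNN n0 => h; rewrite nth_default.
have [->|W0] := eqVneq W 0; first by rewrite mulr0 size_poly0.
by rewrite mulrC size_mulX // ltnS addnC.
Qed.

(* The value at [x] of the degree-[d] homogenisation of [p]. *)
Definition eval_hom (d : nat) (p : {poly CC}) (x : sphere) : CC :=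
  if x is Some z then p.[z] else p`_d.

(** The form of degree d cutting out the fibre through [x]; its order of vanishing at [x] is the
    local degree. *)
Definition value_poly (P Q : {poly CC}) (x : sphere) : {poly CC} :=
  if ratmap P Q x is Some c then P - c *: Q else Q.

Section RationalMap.
Variables P Q : {poly CC}.
Hypothesis ratPQ : is_ratmap P Q.
Let d := rdeg P Q.
Let R := value_poly P Q.

Lemma rdeg_ge2 : (2 <= d)%N.
Proof. exact: (proj2 ratPQ). Qed.

Lemma maxn_size : maxn (size P) (size Q) = d.+1.
Proof. by have := rdeg_ge2; rewrite /d /rdeg; case: (maxn _ _). Qed.

Lemma size_num : (size P <= d.+1)%N. Proof. by rewrite -maxn_size leq_maxl. Qed.
Lemma size_den : (size Q <= d.+1)%N. Proof. by rewrite -maxn_size leq_maxr. Qed.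

Lemma ratmap_proj x : ratmap P Q x = proj (eval_hom d P x) (eval_hom d Q x).
Proof.
case: x => [z|] //=; rewrite /proj.
have := maxn_size; have [lt|le] := ltnP (size Q) (size P).
  move=> sP; rewrite [Q`_d]nth_default ?eqxx //.
  by rewrite -ltnS -sP.
move=> sQ.
have Qd : Q`_d = lead_coef Q by rewrite lead_coefE sQ.
have Q0 : Q`_d != 0 by rewrite Qd lead_coef_eq0 -size_poly_eq0 sQ.
rewrite Q0; case: eqP => [e|ne]; first by rewrite Qd !lead_coefE e sQ.
rewrite [P`_d]nth_default ?mul0r // -ltnS -sQ.
by rewrite ltn_neqAle le andbT; apply/eqP.
Qed.

Lemma eval_hom_neq0 x : (eval_hom d P x != 0) || (eval_hom d Q x != 0).
Proof.
case: x => [z|] /=.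
  rewrite -negb_and; apply/negP => /andP[Pz Qz].
  by have := coprimep_root (proj1 ratPQ) Pz; rewrite Qz.
have nz (p : {poly CC}) : size p = d.+1 -> p`_d != 0.
  move=> sp; have : lead_coef p != 0 by rewrite lead_coef_eq0 -size_poly_eq0 sp.
  by rewrite lead_coefE sp.
have := maxn_size; have [le|/ltnW le] := leqP (size P) (size Q).
  by move=> sQ; rewrite [X in _ || X]nz // orbT.
by move=> sP; rewrite nz.
Qed.

(** If P = c Q, coprimality makes [Q] constant, and then the degree is 0. *)
Lemma lincomb_neq0 (c : CC) : P - c *: Q != 0.
Proof.
rewrite subr_eq0; apply/negP => /eqP e.
have Q1 : size Q == 1 by have := (proj1 ratPQ); rewrite e; have [->|c0] := eqVneq c 0;
  rewrite ?scale0r ?coprime0p ?coprimepZl ?coprimepp -?size_poly_eq1.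
have : (d.+1 <= 1)%N.
  by rewrite -maxn_size geq_max {1}e (leq_trans (size_scale_leq _ _)) (eqP Q1).
by rewrite ltnS leqn0 => /eqP d0; have := rdeg_ge2; rewrite d0.
Qed.

Lemma value_poly_neq0 x : R x != 0.
Proof.
rewrite /R /value_poly; case e: (ratmap P Q x) => [c|]; first exact: lincomb_neq0.
apply/negP => /eqP Q0; have := (proj1 ratPQ); rewrite Q0 coprimep0 -size_poly_eq1 => /eqP sP.
by have := maxn_size; have := rdeg_ge2; rewrite sP Q0 size_poly0 -/d; lia.
Qed.

Lemma size_value_poly x : (size (R x) <= d.+1)%N.
Proof.
rewrite /R /value_poly; case: ratmap => [c|]; last exact: size_den.
rewrite (leq_trans (size_polyD _ _)) // geq_max size_num size_polyN.
by rewrite (leq_trans (size_scale_leq _ _)) ?size_den.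
Qed.

Lemma eval_hom_lincomb (a b : CC) x :
  eval_hom d (a *: P + b *: Q) x = a * eval_hom d P x + b * eval_hom d Q x.
Proof. by case: x => [z|]; rewrite /eval_hom; [rewrite hornerD !hornerZ | rewrite coefD !coefZ]. Qed.

Lemma value_poly_root x : eval_hom d (R x) x = 0.
Proof.
have := ratmap_proj x; rewrite /R /value_poly /proj.
case: eqVneq => [e|n0]; rewrite /negb => -> //.
have e (c : CC) : P - c *: Q = 1 *: P + - c *: Q by rewrite scale1r scaleNr.
by rewrite e eval_hom_lincomb; field.
Qed.

Lemma local_degree_value_poly x : local_degree P Q x =
  if x is Some z then mup z (R x) else (d.+1 - size (R x))%N.
Proof.
by rewrite /local_degree /R /value_poly; case: x => [z|]; case: ratmap.
Qed.

Let W := P^`() * Q - P * Q^`().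

(* Replacing P by P - cQ does not change the Wronskian, and exchanging P and
   Q changes its sign. *)
Lemma wronskian_value_poly x : exists S : {poly CC}, [/\ eval_hom d S x != 0,
  (W == (R x)^`() * S - R x * S^`()) || (- W == (R x)^`() * S - R x * S^`()) &
  (size S <= d.+1)%N].
Proof.
have := ratmap_proj x; rewrite /R /value_poly /proj.
case: eqVneq => [e|n0]; rewrite /negb => -> //.
  exists P; split.
  - by have := eval_hom_neq0 x; rewrite e eqxx orbF.
  - by apply/orP; right; apply/eqP; rewrite /W; ring.
  - exact: size_num.
exists Q; split; rewrite ?size_den //; apply/orP; left; apply/eqP.
by rewrite /W derivB derivZ -!mul_polyC; ring.
Qed.

Lemma wronskian_mup z : mup z W = (local_degree P Q (Some z)).-1.
Proof.
have [S [Sz eW _]] := wronskian_value_poly (Some z).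
rewrite local_degree_value_poly.
have Rz : root (R (Some z)) z by apply/eqP/(value_poly_root (Some z)).
have mW := mup_wronskian (value_poly_neq0 (Some z)) Rz Sz.
case/orP: eW => /eqP e; rewrite -mW -e // -[in RHS]scaleN1r -mul_polyC mupMr //.
by rewrite rootC oppr_eq0 oner_neq0.
Qed.

Lemma local_degree_le x : (local_degree P Q x <= d)%N.
Proof.
rewrite local_degree_value_poly; have R0 := value_poly_neq0 x.
case: x R0 => [z|] R0; last by rewrite leq_subLR -addn1 addnC leq_add2r size_poly_gt0.
have : ('X - z%:P) ^+ mup z (R (Some z)) %| R (Some z) by rewrite -mup_geq.
move/(dvdp_leq R0); rewrite size_exp_XsubC => h.
by rewrite -ltnS (leq_trans h) ?size_value_poly.
Qed.

(** As a form of degree 2d - 2, [W] vanishes at infinity to order 2d - 1 - size W; the bound says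
    that this is at most the local degree minus one. *)
Lemma wronskian_size : (2 * d <= size W + local_degree P Q None)%N.
Proof.
have [S [S0 eW sS]] := wronskian_value_poly None.
rewrite local_degree_value_poly.
have sS' : size S = d.+1.
  apply/eqP; rewrite eqn_leq sS ltnNge; apply: contraNN S0 => h.
  by apply/eqP; exact: nth_default.
have R0 := value_poly_neq0 None.
have sR : (size (R None) <= d)%N.
  apply/leq_sizeP => j; rewrite leq_eqVlt => /orP[/eqP<-|h].
    exact: (value_poly_root None).
  by rewrite nth_default // (leq_trans (size_value_poly _)).
have := size_wronskian R0 sS' sR.
have -> : size ((R None)^`() * S - R None * S^`()) = size W.
  by case/orP: eW => /eqP <-; rewrite ?size_polyN.
have ar r w : (r <= d)%N -> (0 < r)%N -> (d + r.-1 <= w)%N -> (2 * d <= w + (d.+1 - r))%N.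
  by clear; lia.
by apply: ar sR _; rewrite size_poly_gt0.
Qed.

(* Riemann-Hurwitz: the Wronskian has degree at most 2d - 2, and its order
   at a point is the local degree minus one. *)
Lemma bicritical_local_degree (c1 c2 : sphere) : c1 <> c2 ->
  (forall x, critical_point P Q x <-> (x = c1 \/ x = c2)) ->
  local_degree P Q c1 = d /\ local_degree P Q c2 = d.
Proof.
move=> c12 crit.
have [rs eW] := closed_field_poly_normal W.
have d2 := rdeg_ge2; have l1 := local_degree_le c1; have l2 := local_degree_le c2.
have W0 : W != 0.
  rewrite -size_poly_gt0; have := wronskian_size; have := local_degree_le None; lia.
have cW : lead_coef W != 0 by rewrite lead_coef_eq0.
have sW : size W = (size rs).+1 by rewrite eW size_scale // size_prod_XsubC.
have cnt z : count_mem z rs = (local_degree P Q (Some z)).-1.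
  rewrite -wronskian_mup eW -mul_polyC mupMr ?mu_prod_XsubC //.
  by rewrite rootC.
have mem z : z \in rs -> Some z = c1 \/ Some z = c2.
  move=> zr; apply/crit; rewrite /critical_point.
  have : (0 < count_mem z rs)%N by rewrite -has_count has_pred1.
  by rewrite cnt; case: local_degree => [|[]].
(* The number of roots of [W] at [c], which is 0 for infinity. Every root of [W] is critical, so
   [c1] and [c2] account for all of [rs]. *)
pose n c := count (fun z => Some z == c) rs.
have sn : size rs = (n c1 + n c2)%N.
  have split2 z : z \in rs -> (Some z == c1) = ~~ (Some z == c2).
    move=> zr; have [e|ne] := eqVneq (Some z) c2.
      by apply/negbTE/eqP => e1; apply: c12; rewrite -e1 -e.
    by apply/eqP; have [//|e] := mem z zr; rewrite e eqxx in ne.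
  by rewrite -(count_predC (fun z => Some z == c2) rs) addnC /n (eq_in_count split2).
have nle c : (n c <= (local_degree P Q c).-1)%N.
  case: c => [z|]; last by rewrite /n count_pred0.
  by rewrite -cnt; apply: eq_leq; apply: eq_count => y /=.
have := wronskian_size; rewrite sW sn.
have n1 := nle c1; have n2 := nle c2.
have c1ge : (2 <= local_degree P Q c1)%N by apply/crit; left.
have c2ge : (2 <= local_degree P Q c2)%N by apply/crit; right.
(* In each case the local degrees of [c1] and [c2] add up to at least 2d, while neither exceeds
   d. *)
case: (pselect (critical_point P Q None)) => [/crit [] e|nc].
- have -> : n c1 = 0%N by rewrite -e /n count_pred0.
  by rewrite e; lia.
- have -> : n c2 = 0%N by rewrite -e /n count_pred0.
  by rewrite e; lia.
- by move/negP: nc; rewrite -ltnNge; lia.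
Qed.

(** Coefficients of a linear form in homogeneous coordinates whose only zero is [c]. *)
Definition linear_form (c : sphere) : CC * CC := if c is Some z then (1, - z) else (0, 1).

Definition eval_linear (c x : sphere) : CC :=
  if x is Some z then (linear_form c).1 * z + (linear_form c).2 else (linear_form c).1.

(** A form of degree d vanishing to order d at [c] is a constant times the d-th power of the linear
    form of [c]. For infinity this is k Y^d, which dehomogenises to a constant polynomial. *)
Lemma full_local_degree c : local_degree P Q c = d ->
  exists2 k : CC, k != 0 & forall x, eval_hom d (R c) x = k * eval_linear c x ^+ d.
Proof.
rewrite local_degree_value_poly; have R0 := value_poly_neq0 c.
have d2 := rdeg_ge2; have sR := size_value_poly c.
case: c R0 sR => [z|] R0 sR e.
  have : ('X - z%:P) ^+ d %| R (Some z) by rewrite -mup_geq ?e.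
  case/dvdpP => q eR.
  have q0 : q != 0 by apply: contraNneq R0 => q0; rewrite eR q0 mul0r.
  have X0 : ('X - z%:P) ^+ d != 0 by rewrite expf_neq0 // polyXsubC_eq0.
  have /size_poly1P[k k0 eq] : size q == 1.
    move: sR; rewrite eR size_mul // size_exp_XsubC addnS -pred_Sn -(add1n d) leq_add2r => q1.
    by rewrite eqn_leq q1 size_poly_gt0.
  exists k => // x; rewrite eR eq mul_polyC /eval_hom /eval_linear /linear_form; case: x => [y|].
    by rewrite hornerZ horner_exp hornerXsubC mul1r.
  rewrite coefZ expr1n; congr (_ * _).
  have := monic_exp d (monicXsubC z); rewrite monicE lead_coefE size_exp_XsubC /=.
  by move/eqP.
have /size_poly1P[k k0 eq] : size (R None) == 1%N.
  have ar r : (r <= d.+1)%N -> (0 < r)%N -> (d.+1 - r)%N = d -> r == 1%N by clear -d2; lia.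
  by apply: ar sR _ e; rewrite size_poly_gt0.
exists k => // -[y|]; rewrite eq /eval_hom /eval_linear /linear_form.
  by rewrite hornerC mul0r add0r expr1n mulr1.
by rewrite coefC expr0n; case: (d) d2 => //= n _; rewrite mulr0.
Qed.

End RationalMap.

Lemma power_map_proj d (u v : CC) : (0 < d)%N ->
  power_map d (proj u v) = proj (u ^+ d) (v ^+ d).
Proof.
move=> d0; rewrite /proj expf_eq0 d0; case: (v == 0) => //.
by rewrite /= expr_div_n.
Qed.

Lemma linear_form_det (c1 c2 : sphere) : c1 <> c2 ->
  (linear_form c1).1 * (linear_form c2).2 - (linear_form c1).2 * (linear_form c2).1 != 0.
Proof.
case: c1 c2 => [z1|] [z2|] ne //; rewrite /linear_form /fst /snd.
- by rewrite mul1r mulr1 opprK addrC subr_eq0; apply/eqP => e; apply: ne; rewrite e.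
- by rewrite mulr1 mulr0 subr0 oner_neq0.
- by rewrite mul0r mulr1 sub0r oppr_eq0 oner_neq0.
Qed.

Lemma eval_linear_eq0 c x : eval_linear c x = 0 -> c = x.
Proof.
case: c x => [z|] [y|] //; rewrite /eval_linear /linear_form /fst /snd.
- by rewrite mul1r => /eqP; rewrite subr_eq0 => /eqP->.
- by move/eqP; rewrite oner_eq0.
- by rewrite mul0r add0r => /eqP; rewrite oner_eq0.
Qed.

Lemma proj_linear c1 c2 x : proj (eval_linear c1 x) (eval_linear c2 x) =
  mobius_fun (linear_form c1).1 (linear_form c1).2 (linear_form c2).1 (linear_form c2).2 x.
Proof.
pose u : CC := if x is Some z then z else 1; pose v : CC := if x is Some z then 1 else 0.
have nz : (u != 0) || (v != 0) by rewrite /u /v; case: (x) => [z|]; rewrite oner_neq0 ?orbT.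
have ex : x = proj u v.
  by rewrite /u /v /proj; case: (x) => [z|]; rewrite ?eqxx // oner_neq0 divr1.
have el c : eval_linear c x = (linear_form c).1 * u + (linear_form c).2 * v.
  by rewrite /u /v /eval_linear; case: (x) => [z|]; rewrite ?mulr1 // mulr0 addr0.
by rewrite !el [in RHS]ex mobius_proj.
Qed.

Lemma bicritical_power_form (P Q : {poly CC}) : bicritical P Q ->
  exists A B, [/\ is_mobius A, is_mobius B &
                 forall x, ratmap P Q x = A (power_map (rdeg P Q) (B x))].
Proof.
move=> [ratPQ [c1 [c2 [c12 crit]]]].
have [e1 e2] := bicritical_local_degree ratPQ c12 crit.
have [k1 k10 f1] := full_local_degree ratPQ e1.
have [k2 k20 f2] := full_local_degree ratPQ e2.
have d0 : (0 < rdeg P Q)%N := ltnW (rdeg_ge2 ratPQ).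
set d := rdeg P Q in f1 f2 d0 *.
pose a (c : sphere) : CC := (linear_form (ratmap P Q c)).1.
pose b (c : sphere) : CC := (linear_form (ratmap P Q c)).2.
have vp c x : eval_hom d (value_poly P Q c) x = a c * eval_hom d P x + b c * eval_hom d Q x.
  rewrite -eval_hom_lincomb /a /b /value_poly; congr eval_hom.
  by case: ratmap => [w|]; rewrite /linear_form /fst /snd ?scale1r ?scale0r ?add0r // scaleNr.
(* If the critical values agreed, one form would vanish at [c1] and also be a nonzero multiple of a
   power vanishing only at [c2]. *)
have v12 : ratmap P Q c1 <> ratmap P Q c2.
  move=> e; have eR : value_poly P Q c1 = value_poly P Q c2 by rewrite /value_poly e.
  have := f2 c1; rewrite -eR (value_poly_root ratPQ) => /esym/eqP.
  rewrite mulf_eq0 (negbTE k20) expf_eq0 d0 => /eqP/eval_linear_eq0 e'.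
  by apply: c12.
have D := linear_form_det v12; have D' := linear_form_det c12.
(* [M] sends the value at [c1] to 0 and the value at [c2] to infinity. After it, the map is the
   quotient of two d-th powers of linear forms, with the constants [k1] and [k2] absorbed by [K]. *)
pose M := mobius_fun (a c1) (b c1) (a c2) (b c2).
have [N [NM MK NK]] : exists s, [/\ is_mobius s, cancel M s & cancel s M].
  by apply: mobius_inv; exists (a c1), (b c1), (a c2), (b c2).
pose K := mobius_fun k1 0 0 k2.
exists (N \o K), (mobius_fun (linear_form c1).1 (linear_form c1).2
                            (linear_form c2).1 (linear_form c2).2).
split.
- apply: mobius_comp => //; exists k1, 0, 0, k2; split=> //.
  by rewrite mulr0 subr0 mulf_neq0.
- by do 4!eexists; split; first exact: D'.
move=> x; apply: (can_inj MK); rewrite -[RHS]/(M (N _)) NK.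
rewrite (ratmap_proj ratPQ) -/d /M mobius_proj ?eval_hom_neq0 // -!vp f1 f2.
rewrite -proj_linear power_map_proj // /K mobius_proj ?mul0r ?addr0 ?add0r //.
rewrite !expf_eq0 d0 -negb_and; apply/negP => /andP[/eqP/eval_linear_eq0 h1 /eqP/eval_linear_eq0 h2].
by apply: c12; rewrite h1 h2.
Qed.

(** * Deck groups *)

Lemma deck_id F : Deck F id.
Proof. by split; first exact: mobius_id. Qed.

Lemma deck_comp F t s : Deck F t -> Deck F s -> Deck F (t \o s).
Proof.
move=> [tM tF] [sM sF]; split; first exact: mobius_comp.
by move=> x; rewrite /= tF sF.
Qed.

Lemma mobius_eq3 t s (x y z : sphere) : is_mobius t -> is_mobius s ->
  x != y -> x != z -> y != z -> t x = s x -> t y = s y -> t z = s z -> t = s.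
Proof.
move=> tM sM xy xz yz ex ey ez; have [r [rM sK rK]] := mobius_inv sM.
have h := @mobius_fix3 (r \o t) x y z (mobius_comp rM tM) xy xz yz.
apply: funext => u; apply: (can_inj rK); rewrite sK.
by apply: h; rewrite /= ?ex ?ey ?ez sK.
Qed.

(** A deck transformation is determined by its values at three points, which lie in finite fibres.
    So there are finitely many, each having at most two fixed points unless it is the identity. *)
Lemma deck_fixpoints_finite F : finite_fibres F ->
  exists l : seq sphere, forall t x, Deck F t -> t <> id -> t x = x -> x \in l.
Proof.
move=> fF; pose p0 : sphere := Some 0; pose p1 : sphere := Some 1; pose p2 : sphere := None.
have p01 : p0 != p1 by apply/eqP => -[/esym/eqP]; rewrite oner_eq0.
have [l el] := finite_preimage [:: F p0; F p1; F p2] fF.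
have tl t : Deck F t -> [/\ t p0 \in l, t p1 \in l & t p2 \in l].
  by move=> [_ tF]; split; apply/el; rewrite tF !inE eqxx ?orbT.
pose val3 (t : sphere -> sphere) := ((t p0, t p1), t p2).
(* Induction on a list of candidate value triples: each triple belongs to at most one deck
   transformation. *)
suff main (A : seq (sphere * sphere * sphere)) : exists l : seq sphere,
    forall t x, Deck F t -> val3 t \in A -> t <> id -> t x = x -> x \in l.
  have [l' h] := main [seq (ab, c) | ab <- [seq (a, b) | a <- l, b <- l], c <- l].
  exists l' => t x Dt; apply: h => //.
  by have [h0 h1 h2] := tl t Dt; apply: allpairs_f => //; apply: allpairs_f.
elim: A => [|a A [l' IH]]; first by exists [::].
case: (pselect (exists t, [/\ Deck F t, val3 t = a & t <> id])) => [[t [Dt ta tid]]|no].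
  have [|l1 h1] := mobius_at_most_two_fix Dt.1.
    by move=> h; apply: tid; apply: funext.
  exists (l1 ++ l') => s x Ds; rewrite in_cons mem_cat => /orP[/eqP sa|sA] sid sx.
    have e : s = t.
      move: sa; rewrite -ta => -[e0 e1 e2].
      exact: (@mobius_eq3 s t p0 p1 p2 Ds.1 Dt.1).
    by rewrite h1 // -e.
  by rewrite (IH s) ?orbT.
exists l' => s x Ds; rewrite in_cons => /orP[/eqP sa|sA] sid sx; last exact: (IH s).
by case: no; exists s.
Qed.

Lemma sphere_avoid (l : seq sphere) : exists w, w \notin l.
Proof.
pose f (k : nat) : sphere := Some k%:R.
have finj : injective f by move=> a b [/eqP]; rewrite eqr_nat => /eqP.
pose s := map f (iota 0 (size l).+1).
have us : uniq s by rewrite map_inj_uniq ?iota_uniq.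
have [w _ wl] : exists2 w, w \in s & w \notin l.
  apply/hasP; rewrite has_predC; apply/negP => /allP h.
  by have := uniq_leq_size us h; rewrite size_map size_iota ltnn.
by exists w.
Qed.

Lemma free_action_dvdn (T : finType) (G : {group {perm T}}) (X : {set T}) :
  [acts G, on X | 'P]%g -> (forall g x, g \in G -> x \in X -> g x = x -> g = 1%g) ->
  (#|G| %| #|X|)%N.
Proof.
move=> aX free; rewrite -(acts_sum_card_orbit aX).
apply: dvdn_sum => A /imsetP[x xX ->]; rewrite -(card_orbit_stab 'P%act G x).
suff -> : 'C_G[x | 'P]%g = 1%g by rewrite cards1 muln1.
apply/trivgP/subsetP => g /setIP[gG /astab1P gx]; rewrite inE; apply/eqP.
exact: free gG xX gx.
Qed.

(* [T] consists of full fibres of [F], among them those of all fixed points of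
   deck transformations, so that the deck group acts faithfully on [T] with
   the same fixed points as on the sphere. *)
Lemma deck_permutation_group F n : finite_fibres F -> generic_fibre_size F n ->
  exists (T : finType) (i : T -> sphere) (G : {group {perm T}})
         (tau : {perm T} -> sphere -> sphere),
  [/\ injective i,
      forall t s, is_mobius t -> is_mobius s -> (forall x, t (i x) = s (i x)) -> t = s,
      forall t x, Deck F t -> t <> id -> t x = x -> exists y, i y = x,
      (forall p, p \in G -> Deck F (tau p) /\ forall x, tau p (i x) = i (p x)) /\
      (forall t, Deck F t -> exists2 p, p \in G & tau p = t) &
      (#|G| %| n)%N].
Proof.
move=> fF [bad gF]; have [fix_l fixP] := deck_fixpoints_finite fF.
(* A generic value whose fibre contains no fixed point of a nontrivial deck transformation: the
   action on this fibre of size [n] is free, which gives the divisibility. *)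
have [w] := sphere_avoid (bad ++ map F fix_l).
rewrite mem_cat negb_or => /andP[wbad wfix].
have [lw [ulw slw elw]] := gF w wbad.
pose p0 : sphere := Some 0; pose p1 : sphere := Some 1; pose p2 : sphere := None.
pose V := [:: w, F p0, F p1, F p2 & map F fix_l].
have [l el] := finite_preimage V fF.
pose T : finType := seq_sub l; pose i (x : T) : sphere := val x.
have iinj : injective i by exact: val_inj.
have onto x : x \in l -> exists y, i y = x by move=> xl; exists (SeqSub xl).
have [a0 ea0] : exists y, i y = p0 by apply/onto/el; rewrite !inE eqxx ?orbT.
have [a1 ea1] : exists y, i y = p1 by apply/onto/el; rewrite !inE eqxx ?orbT.
have [a2 ea2] : exists y, i y = p2 by apply/onto/el; rewrite !inE eqxx ?orbT.
have p01 : p0 != p1 by apply/eqP => -[/esym/eqP]; rewrite oner_eq0.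
have ext t s : is_mobius t -> is_mobius s -> (forall x, t (i x) = s (i x)) -> t = s.
  move=> tM sM h; apply: (@mobius_eq3 t s p0 p1 p2) => //.
  - by rewrite -ea0.
  - by rewrite -ea1.
  - by rewrite -ea2.
have inT t x : Deck F t -> t <> id -> t x = x -> exists y, i y = x.
  move=> Dt tid tx; apply/onto/el; rewrite !in_cons map_f ?orbT //.
  exact: fixP tx.
pose G0 := [set p : {perm T} | `[< exists t, Deck F t /\ forall x, t (i x) = i (p x) >]].
have G0P : group_set G0.
  apply/group_setP; split.
    by rewrite inE; apply/asboolP; exists id; split; [exact: deck_id | move=> x; rewrite perm1].
  move=> p q; rewrite !inE => /asboolP[t [Dt tp]] /asboolP[s [Ds sq]].
  apply/asboolP; exists (s \o t); split; first exact: deck_comp.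
  by move=> x; rewrite /= tp sq permM.
have [tau tauP] : {tau : {perm T} -> sphere -> sphere & forall p, p \in G0 ->
    Deck F (tau p) /\ forall x, tau p (i x) = i (p x)}.
  apply: (@choice _ _ (fun p t => p \in G0 -> Deck F t /\ forall x, t (i x) = i (p x))) => p.
  case: (boolP (p \in G0)) => [|_]; last by exists id.
  by rewrite inE => /asboolP[t h]; exists t.
have tau_onto t : Deck F t -> exists2 p, p \in G0 & tau p = t.
  move=> Dt; have [tM tF] := Dt.
  have tl (x : T) : t (i x) \in l by apply/el; rewrite tF; apply/el; exact: valP.
  have tinj : injective (fun x : T => SeqSub (tl x) : T).
    move=> x y /(congr1 i); rewrite /i /= => e; apply: iinj.
    have [r [_ tK _]] := mobius_inv tM; exact: (can_inj tK).
  have pG : perm tinj \in G0.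
    by rewrite inE; apply/asboolP; exists t; split=> // x; rewrite permE.
  exists (perm tinj) => //; apply: ext; [exact: (tauP _ pG).1.1 | exact: tM |].
  by move=> x; rewrite (tauP _ pG).2 permE.
exists T, i, (Group G0P), tau; split=> //.
pose X := [set x : T | F (i x) == w].
have -> : n = #|X|.
  rewrite -slw cardE -(size_map i); apply: perm_size; apply: uniq_perm => //.
    by rewrite map_inj_uniq ?enum_uniq.
  move=> x; apply/idP/mapP => [xl|[y]].
    have /onto[y yx] : x \in l by apply/el; rewrite (elw x).2 // mem_head.
    by exists y => //; rewrite mem_enum inE yx (elw x).2.
  by rewrite mem_enum inE => /eqP yw ->; apply/elw.
apply: free_action_dvdn.
  apply/actsP => p pG x /=; rewrite !inE /aperm -(tauP p pG).2.
  by rewrite (tauP p pG).1.2.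
move=> p x pG; rewrite inE => /eqP xw px; have [Dp tp] := tauP p pG.
have [e|ne] := pselect (tau p = id).
  by apply/permP => y; rewrite perm1; apply: iinj; rewrite -tp e.
case/negP: wfix; rewrite -xw map_f //; apply: (fixP (tau p)) => //.
by rewrite tp px.
Qed.

Lemma deck_cyclic_or_dihedral F d k rho x0 :
  finite_fibres F -> generic_fibre_size F (d ^ k) -> (1 < d)%N ->
  Deck F rho -> rho x0 = x0 -> (forall m, iterate m rho =1 id -> (d %| m)%N) ->
  cyclic_group (Deck F) \/ (~~ odd d /\ dihedral_group (Deck F)).
Proof.
move=> fF gF d1 Drho rhox0 rho_order.
have [T [i [G [tau [iinj ext fixT [tauP tau_onto] dvdG]]]]] := deck_permutation_group fF gF.
have tauD p : p \in G -> Deck F (tau p) by move=> /tauP[].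
have tauM p : p \in G -> is_mobius (tau p) by move=> /tauD[].
have tau_i p x : p \in G -> tau p (i x) = i (p x) by move=> /tauP[].
(* Products of permutations apply the left factor first, so [tau] reverses the order of
   composition. *)
have tau_mul p q : p \in G -> q \in G -> tau (p * q)%g = tau q \o tau p.
  move=> pG qG; apply: ext => [||x]; first by apply: tauM; rewrite groupM.
    by apply: mobius_comp; apply: tauM.
  by rewrite /= !tau_i ?groupM // permM.
have tau1 : tau 1%g = id.
  by apply: ext => [||x]; [apply: tauM | exact: mobius_id | rewrite tau_i // perm1].
have tau_exp p m : p \in G -> tau (p ^+ m)%g = iterate m (tau p).
  move=> pG; elim: m => [|m IH]; first by rewrite expg0 tau1.
  by rewrite expgSr tau_mul ?groupX // IH.
have tau_inj p q : p \in G -> q \in G -> tau p = tau q -> p = q.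
  by move=> pG qG e; apply/permP => x; apply: iinj; rewrite -!tau_i // e.
have tau_order p : p \in G -> finite_order (tau p).
  by move=> pG; exists #[p]%g; rewrite ?order_gt0 // -tau_exp // expg_order tau1.
have tau_neq1 p : p \in G -> p != 1%g -> tau p <> id.
  by move=> pG /eqP p1; rewrite -tau1 => /tau_inj e; apply: p1; apply: e.
have fix2 g : g \in G -> g != 1%g -> #|'Fix_'P[g]%g| = 2.
  move=> gG g1; have gn := tau_neq1 g gG g1.
  have [|x [y [xy e]]] := finite_order_two_fix (tauM g gG) (tau_order g gG).
    by move=> h; apply: gn; apply: funext.
  have [a ea] := fixT _ x (tauD g gG) gn (iffRL (e x) (or_introl erefl)).
  have [b eb] := fixT _ y (tauD g gG) gn (iffRL (e y) (or_intror erefl)).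
  apply/eqP/cards2P; exists a, b; split.
    by apply: contraNneq xy => ab; rewrite -ea -eb ab.
  apply/setP => z; rewrite in_set2; apply/afix1P/orP => [gz|].
    have /e : tau g (i z) = i z by rewrite tau_i // -[X in _ = i X]gz.
    by rewrite -ea -eb => -[]/iinj->; [left | right].
  move=> h; apply: iinj; rewrite -[LHS](tau_i g z gG); apply/e.
  by case: h => /eqP->; [left | right].
have zpowP p t : p \in G -> is_zpow (tau p) t <-> exists2 q, q \in <[p]>%g & t = tau q.
  move=> pG; split=> [[n [h|h]]|[q /cycleP[n ->] ->]].
  - by exists (p ^+ n)%g; [exact: mem_cycle | rewrite tau_exp //; apply: funext].
  - exists (p ^- n)%g; first by rewrite groupV mem_cycle.
    apply: funext => x.
    have e y : tau (p ^- n)%g (tau (p ^+ n)%g y) = y.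
      by rewrite -[LHS]/((tau _ \o tau _) y) -tau_mul ?groupV ?groupX // mulgV tau1.
    by rewrite -[LHS]e tau_exp // h.
  - by exists n; left => x; rewrite tau_exp.
(* The multiplier at the fixed point embeds the stabilizer in the multiplicative group of [CC],
   whose finite subgroups are cyclic. *)
have stab_cyclic x : cyclic 'C_G[x | 'P]%g.
  have [mu [mu1 muM mu_inj]] := stabilizer_multiplier (i x).
  have st p : p \in 'C_G[x | 'P]%g -> p \in G /\ tau p (i x) = i x.
    case/setIP => pG /astab1P px; split=> //.
    by rewrite tau_i //; congr i; exact: px.
  apply: (@field_mul_group_cyclic _ _ _ (fun p => mu (tau p)))
    => [p q /st[pG px] /st[qG qx]|p /st[pG px]].
    by rewrite /= tau_mul // muM 1?mulrC //; apply: tauM.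
  split=> [m1|->]; last by rewrite tau1.
  apply/eqP/negPn/negP => p1; apply: (tau_neq1 p pG p1); apply: funext.
  by apply: mu_inj => //; [exact: tauM | exact: tau_order].
have [r0 r0G er0] := tau_onto rho Drho.
have rho1 : rho <> id.
  move=> e; have := rho_order 1%N; rewrite e => /(_ (fun=> erefl)); rewrite dvdn1.
  by case: d d1 {dvdG gF rho_order} => [|[]].
have [y0 ey0] := fixT rho x0 Drho rho1 rhox0.
have dvd0 : (d %| #|'C_G[y0 | 'P]%g|)%N.
  apply: (@dvdn_trans #[r0]%g).
    by apply: rho_order => x; rewrite -er0 -tau_exp // expg_order tau1.
  apply: order_dvdG; rewrite inE r0G; apply/astab1P; apply: iinj.
  by rewrite -[LHS](tau_i r0 y0 r0G) er0 ey0.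
have [[x Gx]|[od [x ox]]] := rotation_group_orbits d1 dvd0 dvdG fix2.
  left; have := stab_cyclic x; rewrite (setIidPl Gx) => /cyclicP[s eG].
  have sG : s \in G by rewrite eG cycle_id.
  exists (tau s); split=> [|t]; first exact: tauD.
  rewrite zpowP // -eG; split=> [/tau_onto[p pG <-]|[q qG ->]]; [by exists p | exact: tauD].
right; split=> //; have /cyclicP[s eH] := stab_cyclic x.
have inH q : q \in G -> (q \in <[s]>%g) = (q x == x).
  by move=> qG; rewrite -eH inE qG; apply/astab1P/eqP.
have sH : s \in <[s]>%g by exact: cycle_id.
have HG : {subset <[s]>%g <= G} by move=> q; rewrite -eH => /setIP[].
have sG := HG s sH.
have [y yx eo] : exists2 y, y != x & orbit 'P%act G x = [set x; y].
  move/eqP/cards2P: ox => [a [b [ab eo]]].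
  have : x \in [set a; b] by rewrite -eo orbit_refl.
  rewrite !inE => /orP[] /eqP ex; first by exists b; [rewrite ex eq_sym | rewrite {2}ex].
  by exists a; [rewrite ex | rewrite {2}ex setUC].
have in_orb q z : q \in G -> z \in orbit 'P%act G x -> q z \in orbit 'P%act G x.
  move=> qG zo; rewrite -(orbit_eqP zo); exact: (mem_orbit 'P%act z qG).
have swap q : q \in G -> q \notin <[s]>%g -> q x = y /\ q y = x.
  move=> qG; rewrite inH // => qx.
  have e1 : q x = y.
    by have := in_orb q x qG (orbit_refl _ _ _); rewrite eo !inE (negbTE qx) => /eqP.
  split=> //; have := in_orb q y qG; rewrite eo !inE eqxx orbT => /(_ isT) /orP[/eqP//|/eqP qy].
  by case/negP: yx; rewrite -(inj_eq (@perm_inj _ q)) qy e1.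
(* Outside the stabilizer of [x], [q] swaps [x] and [y] and has a fixed point [z] apart from them.
   Its square fixes all three, hence is the identity. *)
have invol q : q \in G -> q \notin <[s]>%g -> (q * q)%g = 1%g.
  move=> qG qH; have [qx qy] := swap q qG qH.
  have q1 : q != 1%g by apply: contraNneq qH => ->; exact: group1.
  have /card_gt0P[z /afix1P qz] : (0 < #|'Fix_'P[q]%g|)%N by rewrite fix2.
  have qz' : q z = z by exact: qz.
  have zx : x != z by apply: contraNneq yx => zx; rewrite -qx zx qz'.
  have zy : y != z by apply: contraNneq yx => zy; rewrite -qy zy qz'.
  apply/eqP/negPn/negP => qq1; have := fix2 _ (groupM qG qG) qq1.
  have /subset_leq_card : [set x; y; z] \subset 'Fix_'P[(q * q)%g]%g.
    apply/subsetP => u; rewrite !in_setU !in_set1 => /orP[/orP[]|] /eqP->; apply/afix1P;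
      by rewrite /= /aperm permM ?qx ?qy ?qx ?qz'.
  by rewrite -setUA !cardsU1 cards1 !inE negb_or zx zy eq_sym yx => h3 e2; rewrite e2 in h3.
(* The orbit of [x] has size two, so its stabilizer has index 2. *)
have [r rG rH] : exists2 r, r \in G & r \notin <[s]>%g.
  apply/subsetPn; apply/negP => /subset_leq_card.
  rewrite -(card_orbit_stab 'P%act G x) ox eH mul2n -addnn -{3}(addn0 #|_|) leq_add2l leqNgt.
  by rewrite cardG_gt0.
have [rx ry] := swap r rG rH.
exists (tau s), (tau r); split; first exact: tauD.
split; first exact: tauD.
split=> [u|]; first by rewrite -[LHS]/((tau r \o tau r) u) -tau_mul // invol // tau1.
split=> [u|].
  (* The dihedral relation says that [s * r] squares to 1, which holds because this product lies
     outside the stabilizer. *)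
  have srG : (s * r)%g \in G by rewrite groupM.
  have -> : tau r (tau s (tau r (tau s u))) = (tau (s * r)%g \o tau (s * r)%g) u.
    by rewrite tau_mul.
  by rewrite -tau_mul // invol ?tau1 // groupMl.
split=> [|t].
  by case/zpowP => // q qH /tau_inj e; case/negP: rH; rewrite e // HG.
split=> [/tau_onto[q qG <-]|[]].
- have [qH|qH] := boolP (q \in <[s]>%g); first by left; apply/zpowP => //; exists q.
  (* Both [r] and [q] swap [x] and [y], so [r * q] fixes [x] and is a power of [s]. *)
  have [qx qy] := swap q qG qH; right; exists (tau (r * q)%g).
  split; first by apply/zpowP => //; exists (r * q)%g; rewrite // inH ?groupM // permM rx qy.
  move=> u; rewrite -[RHS]/((tau _ \o tau r) u) -tau_mul ?groupM //.
  by rewrite mulgA invol // mul1g.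
- by case/zpowP => // q /HG qG ->; exact: tauD.
- case=> u [/zpowP[//|q /HG qG ->]] e.
  have -> : t = tau (r * q)%g by apply: funext => z; rewrite e tau_mul.
  by apply: tauD; rewrite groupM.
Qed.

Lemma iterateSr n (t : sphere -> sphere) x : iterate n.+1 t x = iterate n t (t x).
Proof. exact: iterSr. Qed.

(** Multiplication by a primitive d-th root of unity preserves z^d; conjugating it by [B] gives
    [rho], with the preimage of 0 under [B] as a fixed point. *)
Lemma power_map_rotation (A B : sphere -> sphere) (d : nat) : (0 < d)%N -> is_mobius B ->
  exists rho x0, [/\ is_mobius rho, rho x0 = x0,
    forall x, A (power_map d (B (rho x))) = A (power_map d (B x)) &
    forall m, iterate m rho =1 id -> (d %| m)%N].
Proof.
move=> d0 BM; have [C [CM BK CK]] := mobius_inv BM.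
have [w wp] := prim_root_exists d0.
have w0 : w != 0 by rewrite (prim_root_eq0 wp) -lt0n.
pose r := mobius_fun w 0 0 1.
have rE (z : CC) : r (Some z) = Some (w * z).
  by rewrite /r /mobius_fun mul0r add0r oner_neq0 addr0 divr1.
have rN : r None = None by rewrite /r /mobius_fun eqxx.
have rM : is_mobius r.
  by exists w, 0, 0, 1; split=> //; rewrite mulr1 mulr0 subr0.
exists (C \o r \o B), (C (Some 0)); split.
- by do 2!apply: mobius_comp => //.
- by rewrite -[LHS]/(C (r (B _))) CK rE mulr0.
- move=> x; congr A; rewrite -[in LHS]/(C (r (B x))) CK; case: (B x) => [z|]; last by rewrite rN.
  by rewrite rE /power_map exprMn (prim_expr_order wp) mul1r.
- move=> m /(_ (C (Some 1))); rewrite iterate_conj // => /(can_inj CK).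
  have -> : iterate m r (Some 1) = Some (w ^+ m).
    elim: m => [|m IH]; first by rewrite expr0.
    by rewrite exprS -(rE (w ^+ m)) -IH.
  by case=> /eqP; rewrite (prim_order_dvd wp).
Qed.

Theorem theorem3 (P Q : {poly CC}) (k : nat) :
  bicritical P Q ->
  (cyclic_group (Deck (iterate k (ratmap P Q))) \/
   dihedral_group (Deck (iterate k (ratmap P Q)))) /\
  (odd (rdeg P Q) -> cyclic_group (Deck (iterate k (ratmap P Q)))).
Proof.
move=> bi; have [A [B [AM BM e]]] := bicritical_power_form bi.
have d1 : (1 < rdeg P Q)%N := rdeg_ge2 bi.1.
(* The zeroth iterate is the identity, whose deck group is trivial; the rotation [rho] is a deck
   transformation only for positive iterates. *)
case: k => [|k].
  have iter_id n (x : sphere) : iterate n id x = x by elim: n.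
  have cyc : cyclic_group (Deck (iterate 0 (ratmap P Q))).
    exists id; split=> [|t]; first exact: deck_id.
    split=> [[_ h]|[n h]]; first by exists 0%N; left.
    suff -> : t = id by exact: deck_id.
    by apply: funext => x; case: h => /(_ x); rewrite iter_id.
  by split=> //; left.
have f_eq : ratmap P Q = A \o (power_map (rdeg P Q) \o B) by apply: funext => x; rewrite e.
have [A' [_ AK A'K]] := mobius_inv AM; have [B' [_ BK B'K]] := mobius_inv BM.
have [fA gA] := fibres_bij AK A'K; have [fB gB] := fibres_bij BK B'K.
have [fp gp] := fibres_power_map (ltnW d1).
have ff : finite_fibres (ratmap P Q) by rewrite f_eq; do 2!apply: finite_fibres_comp => //.
have gf : generic_fibre_size (ratmap P Q) (rdeg P Q).
  rewrite -[rdeg P Q in X in generic_fibre_size _ X]mul1n -[X in (1 * X)%N]muln1 f_eq.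
  by do 2!apply: generic_fibre_size_comp => //.
have [fF gF] := fibres_iterate k.+1 ff gf.
have [rho [x0 [rhoM rhox0 rhoF rho_order]]] := power_map_rotation A (ltnW d1) BM.
(* Invariance under [rho] passes from the map applied first to the whole iterate. *)
have Drho : Deck (iterate k.+1 (ratmap P Q)) rho.
  by split=> // x; rewrite !iterateSr !e rhoF.
have [cyc|[nodd dih]] := deck_cyclic_or_dihedral fF gF d1 Drho rhox0 rho_order.
  by split=> //; left.
by split=> [|od]; [right | rewrite od in nodd].
Qed.
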